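(* Let $m>d/2$ and suppose that the covariance function $C$ generates the native space $W_2^m$, and that all other Sobolev spaces $W_2^p$ are defined via scaling (as described in the context). Let $p_{S,W,\mathcal{R}}=\sum_{n\in\mathbb{N}}s_nw_n$ be the expansion paths of $C$ with independent and identically distributed coefficients $S=\{s_n\}_{n\in\mathbb{N}}$ of mean zero and variance one, where $w_n=\sqrt{\lambda_n}\,v_n$. Then these paths lie almost surely in all Sobolev spaces $W_2^p$ for $0\le p<m-d/2$, but almost surely not in $W_2^{m-d/2}$.
   Context: $\Omega\subset\mathbb{R}^d$ is a compact domain on which the spaces are considered. $C$ is a continuous, symmetric, positive definite kernel whose reproducing kernel Hilbert space (native space) $\mathcal{H}(C)$ is the Sobolev space $W_2^m$. Its Mercer (Karhunen–Loève) expansion is $C(x,y)=\sum_{n=1}^\infty\lambda_nv_n(x)v_n(y)$, where $\{v_n\}_{n\in\mathbb{N}}$ is an orthonormal basis of $L_2(\Omega)$ consisting of eigenfunctions, $\int_\Omega C(x,y)v_n(y)\,dy=\lambda_nv_n(x)$, with positive eigenvalues $\lambda_n$ decaying to zero; the functions $w_n=\sqrt{\lambda_n}v_n$ form a complete orthonormal system of $\mathcal{H}(C)$. For native space $W_2^m$ the eigenvalues behave like $\lambda_n\asymp n^{-2m/d}$ for $n\to\infty$ (a known fact used as part of the setting). For a positive sequence $\rho=\{\rho_n\}$, let $L_{2,\rho}(\Omega)$ be the space of all $f\in L_2(\Omega)$ with $\sum_{n=1}^\infty(f,v_n)_{L_2(\Omega)}^2\rho_n^{-1}<\infty$; thus $\mathcal{H}(C)=L_{2,\lambda}(\Omega)$.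 ''Defined via scaling'' means that, with the same fixed basis $\{v_n\}$, the Sobolev space $W_2^p$ for $p\ge0$ is $L_{2,\rho}(\Omega)$ with $\rho_n\asymp n^{-2p/d}$ (so $p=0$ gives $L_2(\Omega)$ and $p=m$ gives $\mathcal{H}(C)$). A path $\sum_ns_nw_n=\sum_ns_n\sqrt{\lambda_n}\,v_n$ lies in $L_{2,\rho}(\Omega)$ if and only if $\sum_{n}s_n^2\lambda_n\rho_n^{-1}<\infty$. *)

(* Defs.v *)
From HB Require Import structures.
From mathcomp Require Import all_boot all_order all_algebra.
From mathcomp Require Import all_classical all_reals all_analysis.

Set Implicit Arguments.
Unset Strict Implicit.
Unset Printing Implicit Defensive.

Import Order.TTheory GRing.Theory Num.Theory.
Import numFieldNormedType.Exports.

Local Open Scope classical_set_scope.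
Local Open Scope ring_scope.

(* The sigma-algebra on R^n generated by the coordinates, i.e. the Borel one. *)
Section measurable_rV.
Context {R : realType} (n : nat).

Let coor : 'I_n -> 'rV[R]_n -> R := fun i x => x ord0 i.

Let rV_set0 : g_sigma_preimage coor set0.
Proof. exact: sigma_algebra0. Qed.

Let rV_setC A : g_sigma_preimage coor A -> g_sigma_preimage coor (~` A).
Proof. exact: sigma_algebraC. Qed.

Let rV_bigcup (F : (set 'rV[R]_n)^nat) :
  (forall i, g_sigma_preimage coor (F i)) ->
  g_sigma_preimage coor (\bigcup_i F i).
Proof. exact: sigma_algebra_bigcup. Qed.

HB.instance Definition _ :=
  @isMeasurable.Build (measure_tuple_display default_measure_display)
    'rV[R]_n (g_sigma_preimage coor) rV_set0 rV_setC rV_bigcup.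

End measurable_rV.

Section lebesgue_rV.
Context {R : realType}.

Lemma measurable_coord n (i : 'I_n) :
  measurable_fun setT (fun x : 'rV[R]_n => x ord0 i).
Proof.
move=> _ Y mY; rewrite setTI; apply: sub_sigma_algebra => /=.
rewrite -bigcup_seq/=; exists i => /=; first by rewrite mem_index_enum.
by exists Y => //; rewrite setTI.
Qed.

Lemma measurable_fun_rV d (T : measurableType d) n (f : T -> 'rV[R]_n) :
  (forall i, measurable_fun setT (fun x => f x ord0 i)) ->
  measurable_fun setT f.
Proof.
move=> mf _ Y mY; rewrite setTI.
suff : @measurable _ 'rV[R]_n `<=` [set A | measurable (f @^-1` A)] by exact.
apply: smallest_sub.
  split => /=; first by rewrite preimage_set0.
  - by move=> A mA; rewrite setTD preimage_setC; exact: measurableC.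
  - by move=> F mF; rewrite preimage_bigcup; exact: bigcup_measurable.
move=> A; rewrite -bigcup_seq => -[i _ [B mB <-]] /=.
rewrite setTI -comp_preimage -[X in measurable X]setTI; exact: mf.
Qed.

Definition cons_rV n (z : R * 'rV[R]_n) : 'rV[R]_n.+1 :=
  \row_i oapp (z.2 ord0) z.1 (unlift ord0 i).

Lemma measurable_cons_rV n : measurable_fun setT (@cons_rV n).
Proof.
apply: measurable_fun_rV => i; case: (unliftP ord0 i) => [j ->|->].
- under eq_fun do rewrite mxE liftK /=.
  apply: (@measurableT_comp _ _ _ _ _ _ (fun x : 'rV[R]_n => x ord0 j)) => //.
  exact: measurable_coord.
- under eq_fun do rewrite mxE unlift_none /=.
  exact: measurable_fst.
Qed.

Section cons_measure.
Context n (m : {sigma_finite_measure set 'rV[R]_n -> \bar R}).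

Let mu1 : {sigma_finite_measure set (measurableTypeR R) -> \bar R} := @lebesgue_measure R.

Definition cons_measure : set 'rV[R]_n.+1 -> \bar R :=
  pushforward (mu1 \x m)%E (@cons_rV n).

Let cons_measure0 : cons_measure set0 = 0%E.
Proof. by rewrite /cons_measure /pushforward preimage_set0 measure0. Qed.

Let cons_measure_ge0 A : (0 <= cons_measure A)%E.
Proof. by rewrite /cons_measure /pushforward; exact: measure_ge0. Qed.

Let cons_measure_sigma_additive : semi_sigma_additive cons_measure.
Proof.
have mc A : measurable A -> measurable (@cons_rV n @^-1` A).
  by move=> mA; rewrite -[X in measurable X]setTI; exact: measurable_cons_rV.
move=> F mF tF mUF; rewrite /cons_measure /pushforward preimage_bigcup.
apply: measure_semi_sigma_additive => [k||]; first exact: mc.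
- apply/trivIsetP => i j _ _ ij; rewrite -preimage_setI.
  by move/trivIsetP : tF => /(_ _ _ _ _ ij) ->//; rewrite preimage_set0.
- by rewrite -preimage_bigcup; exact: mc.
Qed.

HB.instance Definition _ := isMeasure.Build _ _ _ cons_measure
  cons_measure0 cons_measure_ge0 cons_measure_sigma_additive.

Let cons_measure_sigma_finite : sigma_finite setT cons_measure.
Proof.
pose uncons (x : 'rV[R]_n.+1) : R * 'rV[R]_n :=
  (x ord0 ord0, \row_j x ord0 (lift ord0 j)).
have consK : cancel (@cons_rV n) uncons.
  move=> [x y]; congr (_, _) => /=; first by rewrite mxE unlift_none.
  by apply/rowP => j; rewrite !mxE liftK.
have muncons : measurable_fun setT uncons.
  apply: measurable_fun_pair; first exact: measurable_coord.
  apply: measurable_fun_rV => j; under eq_fun do rewrite mxE.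
  exact: measurable_coord.
have /sigma_finiteP[F [FT ndF Foo]] := sigma_finiteT mu1.
have /sigma_finiteP[G [GT ndG Goo]] := sigma_finiteT m.
exists (fun k => uncons @^-1` (F k `*` G k)).
  rewrite -preimage_bigcup -[LHS](preimage_setT uncons); congr (_ @^-1` _).
  apply/esym; rewrite -subTset => -[x y] _.
  have [i _ Fi] : (\bigcup_k F k) x by rewrite -FT.
  have [j _ Gj] : (\bigcup_k G k) y by rewrite -GT.
  exists (maxn i j) => //; split => /=.
  - by move: x Fi; exact/subsetPset/ndF/leq_maxl.
  - by move: y Gj; exact/subsetPset/ndG/leq_maxr.
move=> k; have [mF Fk] := Foo k; have [mG Gk] := Goo k.
have mFG : measurable (F k `*` G k) by exact: measurableX.
split; first by rewrite -[X in measurable X]setTI; exact: muncons.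
rewrite /cons_measure /pushforward -comp_preimage.
rewrite (_ : uncons \o _ = id); last by apply/funext => z /=; rewrite consK.
by rewrite preimage_id product_measure1E// lte_mul_pinfty// ge0_fin_numE.
Qed.

HB.instance Definition _ := Measure_isSigmaFinite.Build _ _ _ cons_measure
  cons_measure_sigma_finite.

End cons_measure.

(* Lebesgue measure on R^n, by iterated products; see lebesgue_rV_box. *)
Fixpoint lebesgue_rV n : {sigma_finite_measure set 'rV[R]_n -> \bar R} :=
  if n is k.+1 then cons_measure (lebesgue_rV k) else \d_(0 : 'rV[R]_0).

Lemma lebesgue_rV_box n (a b : 'rV[R]_n) :
  (forall i, a ord0 i <= b ord0 i) ->
  lebesgue_rV n [set x | forall i, a ord0 i <= x ord0 i <= b ord0 i] =
  (\prod_(i < n) (b ord0 i - a ord0 i))%:E.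
Proof.
elim: n a b => [|n IH] a b ab.
  by rewrite big_ord0 /= diracE mem_set// => -[].
rewrite big_ord_recl EFinM /= /cons_measure /pushforward.
have -> : @cons_rV n @^-1`
    [set x | forall i, a ord0 i <= x ord0 i <= b ord0 i] =
  (`[a ord0 ord0, b ord0 ord0] `*`
  [set y : 'rV[R]_n | forall i, (\row_j a ord0 (lift ord0 j)) ord0 i <= y ord0 i <=
     (\row_j b ord0 (lift ord0 j)) ord0 i])%classic.
  apply/seteqP; split => [[x y]/= h|[x y]/= [hx hy] i].
    split; first by have := h ord0; rewrite !mxE unlift_none in_itv.
    by move=> i; have := h (lift ord0 i); rewrite !mxE liftK.
  rewrite !mxE; case: unliftP => [j ->|->] /=.
    by have := hy j; rewrite !mxE.
  by move: hx; rewrite in_itv.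
rewrite product_measure1E//; last first.
  rewrite [X in measurable X](_ : _ = \bigcap_(i in [set: 'I_n])
     ((fun y : 'rV[R]_n => y ord0 i) @^-1`
       `[a ord0 (lift ord0 i), b ord0 (lift ord0 i)])); last first.
    apply/seteqP; split => [y h i _|y h i].
      by have := h i; rewrite /= in_itv !mxE.
    by have := h i I; rewrite /= in_itv !mxE.
  apply: fin_bigcap_measurable => // i _.
  by rewrite -[X in measurable X]setTI; exact: measurable_coord.
rewrite IH; last by move=> i; rewrite !mxE.
congr (_ * _%:E)%E; last by apply: eq_bigr => i _; rewrite !mxE.
rewrite /= lebesgue_measure_itv /= lte_fin.
have := ab ord0; rewrite le_eqVlt => /predU1P[->|->]; last by rewrite EFinB.
by rewrite ltxx subrr.
Qed.

End lebesgue_rV.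


Section L2_spaces.
Context d (T : measurableType d) (R : realType).
Variables (mu : {measure set T -> \bar R}) (D : set T).
Implicit Types (f g : T -> R) (u v : nat -> T -> R) (lam rho s : nat -> R).

(* Functions on D are represented by functions on T, whose values outside D
   are irrelevant. *)
Definition L2 : set (T -> R) := [set f | f \_ D \in Lfun mu 2%:E].

Definition dotL2 f g : R := \int[mu]_(x in D) (f x * g x).

Definition cvgL2 u f : Prop :=
  ('N[mu]_2%:E[EFin \o ((u n \- f)%R \_ D)])%E @[n --> \oo] --> 0%E.

Definition orthonormal_basis v : Prop :=
  [/\ forall n, L2 (v n),
      forall i j, dotL2 (v i) (v j) = (i == j)%:R &
      forall f, L2 f ->
        cvgL2 (fun n x => \sum_(k < n) dotL2 f (v k) * v k x) f].

(* L_{2,rho} with respect to the basis v. *)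
Definition weighted_L2 v rho : set (T -> R) :=
  [set f | L2 f /\
    (\sum_(0 <= n <oo) (dotL2 f (v n) ^+ 2 / rho n)%:E < +oo)%E].

(* The random series sum_n s_n w_n, w_n = sqrt(lam_n) v_n, converges in L_2
   to an element of the function space W. *)
Definition expansion_path_in v lam s (W : set (T -> R)) : Prop :=
  exists2 f, W f &
    cvgL2 (fun n x => \sum_(k < n) s k * (Num.sqrt (lam k) * v k x)) f.

(* Mercer expansion of C. The sequences are indexed from 0: lam n and v n are
   the eigenvalue and eigenfunction of index n + 1. *)
Definition mercer_expansion (C : T -> T -> R) lam v : Prop :=
  [/\ orthonormal_basis v,
      forall n, 0 < lam n,
      lam n @[n --> \oo] --> 0,
      forall n x, D x -> \int[mu]_(y in D) (C x y * v n y) = lam n * v n x &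
      forall x y, D x -> D y ->
        (\sum_(0 <= k < n) lam k * v k x * v k y) @[n --> \oo] --> C x y].

(* The functions of H (on D) and those of W (modulo equality almost everywhere
   on D) are the same. Two inclusions are used instead of an equivalence since
   a function equal a.e. to an element of H need not be Borel measurable. *)
Definition same_space (H : set (D -> R)) (W : set (T -> R)) : Prop :=
  (forall g, H (g \o set_val) -> W g) /\
  (forall f, W f -> exists2 g, H (g \o set_val) &
    {ae mu, forall x, D x -> f x = g x}).

End L2_spaces.

Section kernels.
Context (R : realType) (X : Type).
Implicit Types K : X -> X -> R.

Definition symmetric_kernel K : Prop := forall x y, K x y = K y x.

Definition positive_definite_kernel K : Prop :=
  forall n (x : 'I_n -> X) (a : 'I_n -> R),
    0 <= \sum_(i < n) \sum_(j < n) a i * a j * K (x i) (x j).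

(* (H, ip) is the Hilbert space of functions on X with reproducing kernel K. *)
Record is_rkhs K (H : set (X -> R)) (ip : (X -> R) -> (X -> R) -> R) : Prop := {
  rkhs_zero : H (fun=> 0);
  rkhs_linear : forall a f g, H f -> H g -> H (fun x => a * f x + g x);
  rkhs_ip_sym : forall f g, H f -> H g -> ip f g = ip g f;
  rkhs_ip_linear : forall a f g h, H f -> H g -> H h ->
    ip (fun x => a * f x + g x) h = a * ip f h + ip g h;
  rkhs_ip_ge0 : forall f, H f -> 0 <= ip f f;
  rkhs_ip_eq0 : forall f, H f -> ip f f = 0 -> f = fun=> 0;
  rkhs_complete : forall u : nat -> X -> R, (forall n, H (u n)) ->
    (forall e, 0 < e -> exists N, forall i j, (N <= i)%N -> (N <= j)%N ->
      ip (fun x => u i x - u j x) (fun x => u i x - u j x) < e) ->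
    exists2 f, H f &
      ip (fun x => u n x - f x) (fun x => u n x - f x) @[n --> \oo] --> 0;
  rkhs_kernel : forall x, H (K x);
  rkhs_reproducing : forall f x, H f -> ip f (K x) = f x
}.

End kernels.

(* rho_n = Theta(n^(-2 p / d)), with rho n standing for the entry of index
   n + 1. *)
Definition sobolev_decay (R : realType) (d : nat) (p : R) (rho : nat -> R) :=
  (rho : nat -> R^o) \is 'Theta_\oo(fun n => n.+1%:R `^ (- (2 * p / d%:R)) : R^o).

Section iid.
Context d (T : measurableType d) (R : realType) (P : probability T R).

Definition mutually_independent (X : nat -> {RV P >-> R}) : Prop :=
  forall (J : seq nat) (B : nat -> set R), uniq J ->
    (forall j, measurable (B j)) ->
    P (\bigcap_(j in [set` J]) X j @^-1` B j) =
    (\prod_(j <- J) P (X j @^-1` B j))%E.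

Definition identically_distributed (X : nat -> {RV P >-> R}) : Prop :=
  forall n (B : set R), measurable B ->
    distribution P (X n) B = distribution P (X 0%N) B.

End iid.

(* Main.v *)
Require Import Defs.
From HB Require Import structures.
From mathcomp Require Import all_boot all_order all_algebra.
From mathcomp Require Import all_classical all_reals all_analysis.
From mathcomp Require Import measurable_realfun.
From mathcomp Require Import ring lra.

(** The theorem reduces to two scalar series.  Expanding along the orthonormal
    basis v, the path with coefficients s_n sqrt(lam_n) lies in L_{2,rho} if
    and only if sum_n s_n^2 lam_n / rho_n is finite (expansion_path_inP): one
    direction recovers the coefficients of the limit by continuity of the inner
    product, the other one is the Riesz-Fischer theorem.  Since lam_n is of
    order n^(-2m/d) and rho_n of order n^(-2p/d), the quotient is of order n^-a
    with a = 2(m-p)/d.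

    If p < m - d/2 then a > 1, so the series sum_n n^-a s_n^2 has the finite
    expectation sum_n n^-a and is finite almost surely.  The exceptional set
    depends on p, which ranges over a continuum; but the series decreases with
    a, so the countably many exponents 1 + 1/(k+1) control all p at once.

    If p = m - d/2 then a = 1, and sum_n s_n^2 / n has to diverge almost surely.
    It dominates a multiple of sum_n 1_(A_n) / n, where A_n is the event
    |s_n| >= 1/2.  The A_n are independent with a common probability q, and
    q > 0 because E[s_n^2] = 1.  The N-th partial sum has expectation q H_N,
    with H_N the harmonic numbers, while its variance is at most the bounded
    number sum_n n^-2; by Chebyshev's inequality it almost surely exceeds every
    bound (ae_weighted_sum_indic_pinfty). *)

Set Implicit Arguments.
Unset Strict Implicit.
Unset Printing Implicit Defensive.

Import Order.TTheory GRing.Theory Num.Theory.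
Import numFieldNormedType.Exports.

Local Open Scope classical_set_scope.
Local Open Scope ring_scope.

(** * Series of nonnegative terms *)

Lemma nneseries_lt_pinfty_cvg (R : realType) (a : nat -> R) :
  (forall n, 0 <= a n) -> (\sum_(0 <= n <oo) (a n)%:E < +oo)%E ->
  cvgn (series a).
Proof.
move=> a0 suma; apply: nondecreasing_is_cvgn.
  by apply: nondecreasing_series => n _ _.
exists (fine (\sum_(0 <= n <oo) (a n)%:E)%E) => _ [n _ <-].
rewrite -lee_fin fineK; last first.
  by rewrite ge0_fin_numE//; apply: nneseries_ge0 => k _ _; rewrite lee_fin.
rewrite /series/= -sumEFin; apply: nneseries_lim_ge => k _ _.
by rewrite lee_fin.
Qed.

Lemma nneseries_le_partial (R : realType) (a : nat -> R) (K : R) :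
  (forall n, 0 <= a n) -> (forall n, \sum_(0 <= k < n) a k <= K) ->
  (\sum_(0 <= n <oo) (a n)%:E <= K%:E)%E.
Proof.
move=> a0 aK; apply: lime_le.
  by apply: is_cvg_nneseries => n _ _; rewrite lee_fin.
by apply: nearW => n; rewrite sumEFin lee_fin.
Qed.

(** Weighted square-summability of the increments replaces their absolute
    summability: |t| <= 2^k t^2 + 2^-k for every real t.  In L_2 the left-hand
    side integrates termwise, so that no triangle inequality is involved. *)
Lemma cvg_telescope_sqr (R : realType) (a : nat -> R) :
  (\sum_(0 <= k <oo) (2 ^+ k * (a k.+1 - a k) ^+ 2)%:E < +oo)%E -> cvgn a.
Proof.
move=> suma.
have w0 n : 0 <= 2 ^+ n * (a n.+1 - a n) ^+ 2.
  by apply: mulr_ge0; [exact: exprn_ge0|exact: sqr_ge0].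
have cw := nneseries_lt_pinfty_cvg w0 suma.
have cg : cvgn (series (geometric (1:R) 2^-1)).
  apply: is_cvg_geometric_series.
  by rewrite ger0_norm ?invf_lt1 ?ltr1n ?invr_ge0.
have ct : cvgn (series (telescope a)).
  apply: normed_cvg.
  apply: (@series_le_cvg _ _ (fun n =>
    2 ^+ n * (a n.+1 - a n) ^+ 2 + geometric (1:R) 2^-1 n)).
  - by move=> n /=.
  - move=> n; apply: addr_ge0; first exact: w0.
    by apply: geometric_ge0; rewrite ?invr_ge0.
  - move=> n; rewrite /= /telescope mul1r exprVn.
    set x := a n.+1 - a n.
    have p : 0 < (2:R) ^+ n by rewrite exprn_gt0.
    (* with y = 2^n |x|, the claim y <= y^2 + 1 is (y - 1)^2 + y >= 0 *)
    rewrite -subr_ge0 (_ : _ - _ =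
        ((2 ^+ n)^-1) * ((2 ^+ n * `|x| - 1) ^+ 2 + 2 ^+ n * `|x|)).
      by rewrite mulr_ge0 ?invr_ge0 ?addr_ge0 ?sqr_ge0 ?mulr_ge0 //; exact: ltW.
    rewrite -(real_normK (num_real x)); field.
    by rewrite gt_eqF.
  - rewrite (_ : series _ = series (fun n => 2 ^+ n * (a n.+1 - a n) ^+ 2) \+
        series (geometric (1:R) 2^-1)).
      exact: is_cvgD.
    by apply/funext => n; rewrite /series/= big_split.
rewrite (_ : a = (fun n => a 0%N + series (telescope a) n)).
  by apply: is_cvgD => //; exact: is_cvg_cst.
by apply/funext => n; exact: eq_sum_telescope.
Qed.

(** The discrete form of (t^-b)' = - b t^(-1-b), from 1 + x <= exp x and
    ln (1 + x) <= x. *)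
Lemma powR_telescope (R : realType) (b : R) (k : nat) : 0 < b ->
  k.+2%:R `^ (- (1 + b)) <= (k.+1%:R `^ (- b) - k.+2%:R `^ (- b)) / b.
Proof.
move=> b0.
have k1 : 0 < k.+1%:R :> R by [].
have k2 : 0 < k.+2%:R :> R by [].
rewrite ler_pdivlMr// lerBrDr.
have -> : k.+1%:R `^ (- b) = k.+2%:R `^ (- b) * expR (- b * (ln (k.+1%:R / k.+2%:R))).
  rewrite /powR !gt_eqF// -expRD; congr expR.
  by rewrite ln_div ?posrE//; ring.
have -> : k.+2%:R `^ (- (1 + b)) = k.+2%:R `^ (- b) * k.+2%:R^-1 :> R.
  by rewrite opprD addrC powRD ?pnatr_eq0 ?implybT// powR_inv1.
rewrite -mulrA -[X in _ + X]mulr1 -mulrDr ler_pM2l ?powR_gt0//.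
apply: le_trans (expR_ge1Dx _); rewrite addrC lerD2l mulNr mulrC -mulrN ler_pM2l//.
rewrite (_ : k.+1%:R / k.+2%:R = 1 + (- k.+2%:R^-1)); last first.
  have x0 : k.+1%:R + 1 != 0 :> R by rewrite natr1 pnatr_eq0.
  by move: x0; rewrite -(natr1 k.+1); set x := k.+1%:R => x0; field.
rewrite lerNr le_ln1Dx//.
by rewrite ltrNl opprK invf_lt1// ltr1n.
Qed.

(** The p-series converges because its terms are dominated by a telescoping
    sequence; the partial sums stay below 1 + 1/(a-1). *)
Lemma nneseries_powR_lt_pinfty (R : realType) (a : R) : 1 < a ->
  (\sum_(0 <= n <oo) (n.+1%:R `^ (- a))%:E < +oo)%E.
Proof.
move=> a1; pose b := a - 1; have b0 : 0 < b by rewrite subr_gt0.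
apply: (@le_lt_trans _ _ (1 + b^-1)%:E); last exact: ltry.
apply: nneseries_le_partial => n; first exact: powR_ge0.
have aE : a = 1 + b by rewrite /b; ring.
case: n => [|n].
  by rewrite big_nil addr_ge0// invr_ge0 ltW.
rewrite big_nat_recl//= powR1 lerD2l.
apply: (@le_trans _ _ (\sum_(0 <= k < n) (k.+1%:R `^ (- b) - k.+2%:R `^ (- b)) / b)).
  by apply: ler_sum => k _; rewrite aE powR_telescope.
rewrite -mulr_suml.
rewrite -[leRHS]mul1r ler_pM2r ?invr_gt0//.
rewrite -[X in X <= _]opprK -sumrN.
rewrite (eq_bigr (fun k => k.+2%:R `^ (- b) - k.+1%:R `^ (- b))); last first.
  by move=> k _; rewrite opprB.
rewrite (telescope_sumr (fun k => k.+1%:R `^ (- b)))// powR1 opprB.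
by rewrite lerBlDr lerDl powR_ge0.
Qed.

(** * Two-sided bounds from asymptotic decay *)

(** The asymptotic comparison only speaks of large indices; positivity of rho
    extends it to all of them, at the price of a larger constant. *)
Lemma sobolev_decay_bounds (R : realType) (d : nat) (p : R) (rho : nat -> R) :
  (forall n, 0 < rho n) -> sobolev_decay d p rho ->
  exists2 K, 0 < K & forall n,
    K^-1 * n.+1%:R `^ (- (2 * p / d%:R)) <= rho n <=
    K * n.+1%:R `^ (- (2 * p / d%:R)).
Proof.
move=> rho0; rewrite /sobolev_decay qualifE => /asboolP[[k1 k2]/= /andP[k10 k20]].
set g := fun n : nat => n.+1%:R `^ (- (2 * p / d%:R)).
move=> [N _ HN].
have g0 n : 0 < g n by rewrite powR_gt0.
(* S bounds both quotients at the finitely many indices below N *)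
pose S := \sum_(n < N) (rho n / g n + g n / rho n).
have term0 n : 0 <= rho n / g n + g n / rho n by rewrite addr_ge0// divr_ge0// ltW.
have S0 : 0 <= S by exact: sumr_ge0.
have i10 : 0 < k1^-1 by rewrite invr_gt0.
exists (k1^-1 + k2 + S); first by lra.
move=> n; have K0 : 0 < k1^-1 + k2 + S by lra.
rewrite ler_pdivrMl//.
suff : rho n / g n <= k1^-1 + k2 + S /\ g n / rho n <= k1^-1 + k2 + S.
  by rewrite !ler_pdivrMr// => -[-> ->].
have [nN|Nn] := ltnP n N.
  have : rho n / g n + g n / rho n <= S.
    by rewrite /S (bigD1 (Ordinal nN))//= lerDl sumr_ge0.
  have : 0 <= rho n / g n by rewrite divr_ge0// ltW.
  have : 0 <= g n / rho n by rewrite divr_ge0// ltW.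
  by lra.
have [] := HN n Nn; rewrite !gtr0_norm// -/(g n) => h1 h2.
have : rho n / g n <= k2 by rewrite ler_pdivrMr.
have : g n / rho n <= k1^-1 by rewrite ler_pdivrMr// ler_pdivlMl.
by lra.
Qed.

Lemma sobolev_decay_le_cst (R : realType) (d : nat) (p : R) (rho : nat -> R) :
  (0 < d)%N -> 0 <= p -> (forall n, 0 < rho n) -> sobolev_decay d p rho ->
  exists K, forall n, 0 < rho n <= K.
Proof.
move=> d0 p0 rho0 /(sobolev_decay_bounds rho0)[K K0 rhoK].
exists K => n; rewrite rho0/=; have /andP[_] := rhoK n.
move=> /le_trans; apply; rewrite -[leRHS]mulr1 ler_pM2l//.
rewrite powRN invf_le1 ?powR_gt0// -[leLHS](powRr0 n.+1%:R) ler_powR ?ler1n//.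
by rewrite divr_ge0// mulr_ge0.
Qed.

Lemma sobolev_decay_ratio (R : realType) (d : nat) (m p : R) (lam rho : nat -> R) :
  (forall n, 0 < lam n) -> (forall n, 0 < rho n) ->
  sobolev_decay d m lam -> sobolev_decay d p rho ->
  exists2 K, 0 < K & forall n, let r := n.+1%:R `^ (- (2 * (m - p) / d%:R)) in
    K^-1 * r <= lam n / rho n <= K * r.
Proof.
move=> lam0 rho0 /(sobolev_decay_bounds lam0)[K1 K10 lamK].
move=> /(sobolev_decay_bounds rho0)[K2 K20 rhoK].
exists (K1 * K2); first exact: mulr_gt0.
move=> n /=; set r := n.+1%:R `^ _.
have /andP[lam1 lam2] := lamK n; have /andP[rho1 rho2] := rhoK n.
have rE : n.+1%:R `^ (- (2 * m / d%:R)) = r * n.+1%:R `^ (- (2 * p / d%:R)).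
  by rewrite /r -powRD ?pnatr_eq0 ?implybT//; congr (_ `^ _); ring.
rewrite rE in lam1 lam2.
have r0 : 0 < r by rewrite powR_gt0.
move: rho1 rho2 lam1 lam2; set g := n.+1%:R `^ _ => rho1 rho2 lam1 lam2.
apply/andP; split.
- rewrite ler_pdivlMr//; apply: le_trans lam1.
  rewrite (_ : K1^-1 * (r * g) = (K1 * K2)^-1 * r * (K2 * g)); last first.
    by field; rewrite !gt_eqF.
  by rewrite ler_pM2l// mulr_gt0// invr_gt0 mulr_gt0.
- rewrite ler_pdivrMr//; apply: (le_trans lam2).
  rewrite (_ : K1 * (r * g) = K1 * K2 * r * (K2^-1 * g)); last first.
    by field; rewrite gt_eqF.
  by rewrite ler_pM2l// !mulr_gt0.
Qed.

(** * The inner product of L_2 *)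

Section L2_inner_product.
Context d (T : measurableType d) (R : realType).
Variables (mu : {measure set T -> \bar R}) (D : set T).
Implicit Types (f g h : T -> R) (v : nat -> T -> R) (c : nat -> R).

Let p12 : (1 <= 2%:E :> \bar R)%E.
Proof. by rewrite lee1n. Qed.

Lemma L2_lin a f g :
  L2 mu D f -> L2 mu D g -> L2 mu D (fun x => a * f x + g x).
Proof.
rewrite /L2/= => f2 g2.
rewrite (_ : _ \_ D = a \o* (f \_ D) \+ g \_ D); last first.
  apply/funext => x; rewrite /= !patchE; case: ifP => _.
    by rewrite mulrC.
  by rewrite mul0r addr0.
apply: (Lfun_addr_closed mu p12).2 => //.
by apply: Lfun_scale => //; rewrite ler1n.
Qed.

Lemma L2_0 : L2 mu D (fun=> 0).
Proof.
rewrite /L2/= (_ : _ \_ D = 0%R); last first.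
  by apply/funext => x; rewrite patchE; case: ifP.
exact: (Lfun_addr_closed mu p12).1.
Qed.

Lemma L2_sum c v n : (forall k, L2 mu D (v k)) ->
  L2 mu D (fun x => \sum_(k < n) c k * v k x).
Proof.
move=> v2; elim: n => [|n IH].
  by under eq_fun do rewrite big_ord0; exact: L2_0.
by under eq_fun do rewrite big_ord_recr/= addrC; exact: L2_lin.
Qed.

Lemma L2_sub f g : L2 mu D f -> L2 mu D g -> L2 mu D (fun x => f x - g x).
Proof.
move=> f2 g2; under eq_fun do rewrite addrC -mulN1r; exact: L2_lin.
Qed.

Lemma dotL2_integrable f g : L2 mu D f -> L2 mu D g ->
  mu.-integrable setT (EFin \o (fun x => f x * g x) \_ D).
Proof.
move=> f2 g2; apply/Lfun1_integrable.
rewrite (_ : _ \_ D = f \_ D \* g \_ D); first exact: Lfun2_mul_Lfun1.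
by apply/funext => x; rewrite /= !patchE; case: ifP => _; rewrite ?mul0r.
Qed.

Lemma dotL2C f g : dotL2 mu D f g = dotL2 mu D g f.
Proof. by apply: eq_Rintegral => x _; rewrite mulrC. Qed.

Lemma dotL2_lin a f g h : L2 mu D f -> L2 mu D g -> L2 mu D h ->
  dotL2 mu D (fun x => a * f x + g x) h = a * dotL2 mu D f h + dotL2 mu D g h.
Proof.
move=> f2 g2 h2; rewrite /dotL2 !(Rintegral_mkcond _ D).
have fh := dotL2_integrable f2 h2; have gh := dotL2_integrable g2 h2.
rewrite -RintegralZl// -RintegralD//.
  apply: eq_Rintegral => x _; rewrite !patchE; case: ifP => _; first ring.
  by rewrite mulr0 addr0.
exact: (integrableZl measurableT a fh).
Qed.

Lemma dotL2_sum c v n h : (forall k, L2 mu D (v k)) -> L2 mu D h ->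
  dotL2 mu D (fun x => \sum_(k < n) c k * v k x) h =
  \sum_(k < n) c k * dotL2 mu D (v k) h.
Proof.
move=> v2 h2; elim: n => [|n IH].
  rewrite big_ord0 /dotL2 (_ : (fun _ => _) = fun=> 0) ?Rintegral0//.
    by rewrite /Rintegral integral0.
  by apply/funext => x; rewrite big_ord0 mul0r.
under [X in dotL2 _ _ X]eq_fun do rewrite big_ord_recr/= addrC.
by rewrite dotL2_lin// ?IH ?big_ord_recr/= 1?addrC//; exact: L2_sum.
Qed.

(** Hoelder's inequality with exponents 2 and 2, applied to the extensions by
    zero; it gives the continuity of the inner product. *)
Lemma dotL2_schwarz f g : L2 mu D f -> L2 mu D g ->
  (`|dotL2 mu D f g|%:E <=
    'N[mu]_2%:E[EFin \o f \_ D] * 'N[mu]_2%:E[EFin \o g \_ D])%E.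
Proof.
move=> f2 g2; rewrite /dotL2 Rintegral_mkcond EFin_normr_Rintegral//; last first.
  exact: dotL2_integrable.
apply: le_trans.
  apply: le_abse_integral => //.
  by have /integrableP[] := dotL2_integrable f2 g2.
have mf : measurable_fun setT (f \_ D).
  by move: f2; rewrite /L2/= inE => /andP[]; rewrite inE.
have mg : measurable_fun setT (g \_ D).
  by move: g2; rewrite /L2/= inE => /andP[]; rewrite inE.
have := @hoelder _ _ _ mu _ _ 2 2 mf mg.
rewrite Lnorm1 => H; apply: le_trans (H _ _ _) => //; last by lra.
rewrite le_eqVlt; apply/orP; left; apply/eqP; apply: eq_integral => x _ /=.
by rewrite !patchE; case: ifP => //; rewrite mul0r.
Qed.

Lemma integral_sqr_dotL2 f : L2 mu D f ->
  (\int[mu]_x ((f \_ D) x ^+ 2)%:E)%E = (dotL2 mu D f f)%:E.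
Proof.
move=> f2; rewrite /dotL2 Rintegral_mkcond /Rintegral fineK.
  apply: eq_integral => x _; congr EFin; rewrite !patchE; case: ifP => //.
  by rewrite expr0n.
exact: integrable_fin_num (dotL2_integrable f2 f2).
Qed.

Lemma L2_measurable f : L2 mu D f -> measurable_fun setT (f \_ D).
Proof. by rewrite /L2/= inE => /andP[]; rewrite inE. Qed.

Lemma sqr_integrable_Lfun2 f : measurable_fun setT f ->
  (\int[mu]_x (f x ^+ 2)%:E < +oo)%E -> f \in Lfun mu 2%:E.
Proof.
move=> mf f2; rewrite inE; apply/andP; split; first by rewrite inE.
rewrite inE/= /finite_norm unlock poweR_lty//.
rewrite (le_lt_trans _ f2)// le_eqVlt; apply/orP; left; apply/eqP.
by apply: eq_integral => x _ /=; rewrite powR_mulrn// real_normK// num_real.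
Qed.

(** Squared distances are the quantities that Fatou's lemma and Pythagoras'
    theorem control; this lemma goes back to the norm. *)
Lemma cvgL2_sqr (u : nat -> T -> R) f (e : nat -> R) :
  e n @[n --> \oo] --> 0 ->
  (forall n, \int[mu]_x (((fun y => u n y - f y) \_ D) x ^+ 2)%:E <= (e n)%:E)%E ->
  cvgL2 mu D u f.
Proof.
move=> e0 ue; rewrite /cvgL2.
have e_ge0 n : 0 <= e n.
  rewrite -lee_fin; apply: le_trans (ue n).
  by apply: integral_ge0 => x _; rewrite lee_fin sqr_ge0.
apply: (@squeeze_cvge _ _ _ _ (fun=> 0%E) _ (fun n => (Num.sqrt (e n))%:E)).
- apply: nearW => n; rewrite Lnorm_ge0/= unlock.
  rewrite -powR12_sqrt// -poweR_EFin.
  apply: gt0_ler_poweR => //; rewrite ?in_itv/= ?leey ?andbT ?lee_fin //.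
    exact: integral_ge0.
  apply: le_trans (ue n); rewrite le_eqVlt; apply/orP; left; apply/eqP.
  by apply: eq_integral => x _ /=; rewrite powR_mulrn// real_normK// num_real.
- exact: cvg_cst.
- apply: cvg_EFin; first exact: nearW.
  rewrite -[X in _ --> X](@sqrtr0 R).
  exact: (cvg_comp _ _ e0 (@sqrt_continuous R 0)).
Qed.

End L2_inner_product.

(** * Completeness of L_2 *)

(** The rate 4^-k leaves room for the weights 2^k of cvg_telescope_sqr, and the
    bound k <= phi k lets every fixed index be overtaken. *)
Lemma fast_subsequence (R : realType) (e : nat -> R) : e n @[n --> \oo] --> 0 ->
  exists phi : nat -> nat,
    [/\ forall k, (phi k <= phi k.+1)%N, forall k, (k <= phi k)%N &
        forall k, e (phi k) <= 2^-1 / (2 ^ k * 2 ^ k)%:R].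
Proof.
move=> e0.
have /choice[N HN] : forall k, exists N, forall n, (N <= n)%N ->
    e n <= 2^-1 / (2 ^ k * 2 ^ k)%:R.
  move=> k; have : 0 < 2^-1 / (2 ^ k * 2 ^ k)%:R :> R.
    by rewrite divr_gt0 ?ltr0n ?muln_gt0 ?expn_gt0.
  move=> /(cvgr_le _ e0)[N _ HN]; exists N => n Nn.
  exact: HN.
exists (fun k => (k + \sum_(i < k.+1) N i)%N); split => k.
- by rewrite [in leqRHS]big_ord_recr/= leq_add// leq_addr.
- exact: leq_addr.
- by apply: HN; rewrite big_ord_recr/= addnA leq_addl.
Qed.

Section L2_completeness.
Context d (T : measurableType d) (R : realType).
Variable mu : {measure set T -> \bar R}.

(** Along a fast subsequence the integral of sum_k 2^k (u_(phi k+1) - u_(phi k))^2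
    is finite, whence convergence almost everywhere by cvg_telescope_sqr; Fatou's
    lemma then transfers the bound e to the limit.  The limit is taken as a
    limit superior, which is measurable and vanishes wherever all u_n do; the
    latter keeps limits of functions extended by zero of the same form. *)
Lemma L2_complete (u : nat -> T -> R) (e : nat -> R) :
  (forall n, measurable_fun setT (u n)) ->
  e n @[n --> \oo] --> 0 ->
  (forall n m, (n <= m)%N -> \int[mu]_x ((u m x - u n x) ^+ 2)%:E <= (e n)%:E)%E ->
  exists F : T -> R, [/\ measurable_fun setT F,
    forall n, (\int[mu]_x ((u n x - F x) ^+ 2)%:E <= (e n)%:E)%E &
    forall x, (forall n, u n x = 0) -> F x = 0].
Proof.
move=> mu_ e0 ue.
have [phi [phiS phik ephi]] := fast_subsequence e0.
pose w k x := 2 ^+ k * (u (phi k.+1) x - u (phi k) x) ^+ 2.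
have w0 k x : 0 <= w k x.
  by apply: mulr_ge0; [exact: exprn_ge0|exact: sqr_ge0].
have msqr n (f : T -> R) : measurable_fun setT f ->
    measurable_fun setT (fun x => ((u n x - f x) ^+ 2)%:E : \bar R).
  move=> mf; apply/measurable_EFinP; apply: measurable_funX.
  exact: measurable_funB.
have mw k : measurable_fun setT (EFin \o w k).
  apply/measurable_EFinP; apply: measurable_funM => //; apply: measurable_funX.
  exact: measurable_funB.
have iw k : (\int[mu]_x (w k x)%:E <= (1 / (2 ^ k.+1)%:R)%:E)%E.
  rewrite /w; under eq_integral do rewrite EFinM.
  rewrite ge0_integralZl//.
  - apply: (@le_trans _ _ ((2 ^+ k)%:E * (e (phi k))%:E)%E).
      by rewrite lee_pmul2l ?ue// lte_fin exprn_gt0.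
    rewrite -EFinM lee_fin.
    apply: (le_trans (ler_wpM2l (exprn_ge0 k (ler0n R 2)) (ephi k))).
    rewrite natrM !natrX exprS le_eqVlt; apply/orP; left; apply/eqP; field.
    by rewrite gt_eqF// exprn_gt0.
  - exact: msqr.
  - by move=> x _; rewrite lee_fin sqr_ge0.
have sw : (\int[mu]_x (\sum_(0 <= k <oo) (w k x)%:E) < +oo)%E.
  rewrite (integral_nneseries mu measurableT (f := fun k x => (w k x)%:E))//; last first.
    by move=> k x _; rewrite lee_fin.
  apply: (@le_lt_trans _ _ (\sum_(0 <= k <oo) (1 / (2 ^ k.+1)%:R)%:E)%E).
    apply: lee_nneseries => k _; last exact: iw.
    by move=> _; apply: integral_ge0 => x _; rewrite lee_fin.
  by apply: (le_lt_trans (epsilon_trick0 xpredT (@ler01 R))); rewrite ltry.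
pose F x := fine (limn_esup (fun k => (u (phi k) x)%:E)).
have mF : measurable_fun setT F.
  apply: measurableT_comp => //.
  apply: measurable_fun_limn_esup => k.
  exact/measurable_EFinP.
have cF : {ae mu, forall x, (u (phi k) x) @[k --> \oo] --> F x}.
  have : mu.-integrable setT (fun x => \sum_(0 <= k <oo) (w k x)%:E)%E.
    have mS : measurable_fun setT (fun x => \sum_(0 <= k <oo) (w k x)%:E)%E.
      apply: ge0_emeasurable_sum => k; last by move=> _; exact: mw.
      by move=> x _ _; rewrite lee_fin.
    apply/integrableP; split => //.
    rewrite (le_lt_trans _ sw)//; apply: ge0_le_integral => //.
    - exact: measurableT_comp.
    - move=> x _; rewrite gee0_abs//.
      by apply: nneseries_ge0 => k _ _; rewrite lee_fin.
  move=> /(integrable_ae measurableT); apply: filterS => x /(_ Logic.I) fx.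
  have /cvg_ex[l /= cl] : cvgn (fun k => u (phi k) x).
    apply: cvg_telescope_sqr; rewrite -ge0_fin_numE//.
    by apply: nneseries_ge0 => k _ _; rewrite lee_fin w0.
  suff -> : F x = l by [].
  rewrite /F (_ : limn_esup _ = l%:E)//.
  have /cvg_limn_einf_sup[_ ->//] : (u (phi k) x)%:E @[k --> \oo] --> l%:E.
  by apply: cvg_EFin => //; exact: nearW.
exists F; split => //.
- move=> n.
  (* the shift by n ensures that phi (k + n) >= n for all k *)
  pose g k x := ((u n x - u (phi (k + n)) x) ^+ 2)%:E.
  have mg k : measurable_fun setT (g k) by exact: msqr.
  have g0 k x : setT x -> (0 <= g k x)%E by move=> _; rewrite lee_fin sqr_ge0.
  rewrite (@ae_eq_integral _ _ _ mu setT (fun x => limn_einf (g ^~ x)))//; last 3 first.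
  + exact: msqr.
  + apply: measurableT_comp => //.
    apply: measurable_fun_limn_esup => k.
    exact: measurableT_comp.
  + move: cF; apply: filterS => x cx _; apply/esym.
    have /cvg_limn_einf_sup[->//] : g k x @[k --> \oo] --> ((u n x - F x) ^+ 2)%:E.
    apply: cvg_EFin; first exact: nearW.
    have c1 : u n x - u (phi (k + n)%N) x @[k --> \oo] --> u n x - F x.
      apply: cvgB; first exact: cvg_cst.
      by rewrite (cvg_shiftn n (fun k => u (phi k) x)).
    by rewrite /comp /=; under eq_fun do rewrite expr2; rewrite expr2; exact: cvgM.
  apply: (le_trans (fatou mu measurableT mg g0)).
  rewrite limn_einf_lim; apply: lime_le; first exact: is_cvg_einfs.
  apply: nearW => k; apply: (@le_trans _ _ (\int[mu]_x g k x)%E).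
    by apply: ereal_inf_lbound; exists k => /=.
  rewrite /g; under eq_integral do rewrite -sqrrN opprB.
  by apply: ue; rewrite (leq_trans (leq_addl k n))// phik.
- move=> x u0; rewrite /F (_ : limn_esup _ = 0%:E)//.
  have /cvg_limn_einf_sup[_ ->//] : (u (phi k) x)%:E @[k --> \oo] --> 0%:E.
  under eq_fun do rewrite u0.
  exact: cvg_cst.
Qed.

End L2_completeness.

(** * Expansions along an orthonormal basis *)

Section orthonormal_expansions.
Context d (T : measurableType d) (R : realType).
Variables (mu : {measure set T -> \bar R}) (D : set T) (v : nat -> T -> R).
Hypothesis v_basis : orthonormal_basis mu D v.
Implicit Types (f : T -> R) (c : nat -> R).

Let v_L2 k : L2 mu D (v k). Proof. by case: v_basis. Qed.

Let v_orth i j : dotL2 mu D (v i) (v j) = (i == j)%:R.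
Proof. by case: v_basis. Qed.

Let psum c n x := \sum_(k < n) c k * v k x.

Let psum_L2 c n : L2 mu D (psum c n). Proof. exact: L2_sum. Qed.

Lemma dotL2_psum c n k : dotL2 mu D (psum c n) (v k) = if (k < n)%N then c k else 0.
Proof.
rewrite dotL2_sum//; under eq_bigr do rewrite v_orth.
case: ifPn => [kn|].
  rewrite (bigD1 (Ordinal kn))//= eqxx mulr1 big1 ?addr0// => i ik.
  rewrite (_ : (_ == _) = false) ?mulr0//.
  by apply/negbTE; apply: contra ik => /eqP ik; apply/eqP/val_inj.
rewrite -leqNgt => nk; rewrite big1// => i _.
by rewrite ltn_eqF ?mulr0// (leq_trans _ nk).
Qed.

Lemma dotL2_psum_sqr c n :
  dotL2 mu D (psum c n) (psum c n) = \sum_(k < n) c k ^+ 2.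
Proof.
rewrite {1}/psum dotL2_sum//; apply: eq_bigr => k _.
by rewrite dotL2C dotL2_psum ltn_ord expr2.
Qed.

(** Pythagoras' theorem: a difference of partial sums is again a partial sum,
    whose first n coefficients vanish. *)
Lemma integral_psum_sub_sqr c n m : (n <= m)%N ->
  (\int[mu]_x ((((psum c m \_ D) x - (psum c n \_ D) x) ^+ 2)%R)%:E)%E =
  (\sum_(k < m) c k ^+ 2 - \sum_(k < n) c k ^+ 2)%:E.
Proof.
move=> nm; pose c' k := if (k < n)%N then 0 else c k.
have sumE (F G : nat -> R) : (forall k, G k = if (k < n)%N then 0 else F k) ->
    \sum_(k < m) F k - \sum_(k < n) F k = \sum_(k < m) G k.
  move=> GF; rewrite (big_ord_widen _ _ nm) [X in _ - X]big_mkcond/= -sumrB.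
  by apply: eq_bigr => k _; rewrite GF; case: ifP => _; rewrite ?subrr ?subr0.
rewrite (sumE (fun k => c k ^+ 2) (fun k => c' k ^+ 2)); last first.
  by move=> k; rewrite /c'; case: ifP; rewrite ?expr0n.
rewrite -dotL2_psum_sqr -integral_sqr_dotL2//.
apply: eq_integral => x _; congr (_ ^+ 2)%:E; rewrite !patchE.
case: ifP => _; last by rewrite subr0.
apply: (sumE (fun k => c k * v k x) (fun k => c' k * v k x)) => k.
rewrite /c'; case: ifP => _ //.
by rewrite mul0r.
Qed.

(** Uniqueness of the coefficients: the n-th partial sum has k-th coefficient
    c k as soon as k < n, and taking coefficients is continuous. *)
Lemma dotL2_cvg c f k : L2 mu D f -> cvgL2 mu D (psum c) f ->
  dotL2 mu D f (v k) = c k.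
Proof.
move=> f2 cf; apply/eqP; rewrite eq_sym -subr_eq0 -normr_le0 -lee_fin.
have subf2 n := L2_sub (psum_L2 c n) f2.
have vk_fin : ('N[mu]_2%:E[EFin \o v k \_ D] \is a fin_num)%E.
  rewrite ge0_fin_numE ?Lnorm_ge0//.
  by have := v_L2 k; rewrite /L2/= inE => /andP[_]; rewrite inE.
have c0 : ('N[mu]_2%:E[EFin \o v k \_ D] *
    'N[mu]_2%:E[EFin \o ((psum c n \- f)%R \_ D)])%E @[n --> \oo] --> 0%E.
  by rewrite -(mule0 'N[mu]_2%:E[EFin \o v k \_ D]%E); exact: cvgeZl.
rewrite -[leRHS](cvg_lim (@ereal_hausdorff R) c0); apply: lime_ge.
  by apply/cvg_ex; exists 0%E.
exists k.+1 => // n /= kn; rewrite muleC.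
apply: le_trans (dotL2_schwarz (subf2 n) (v_L2 k)).
rewrite lee_fin [X in `|X|](_ : _ = dotL2 mu D (fun x => psum c n x - f x) (v k))//.
rewrite (_ : (fun x => _) = fun x => -1 * f x + psum c n x); last first.
  by apply/funext => x; rewrite mulN1r addrC.
by rewrite dotL2_lin// dotL2_psum kn mulN1r addrC.
Qed.

Lemma riesz_fischer c : (\sum_(0 <= k <oo) (c k ^+ 2)%:E < +oo)%E ->
  exists2 f, L2 mu D f & cvgL2 mu D (psum c) f.
Proof.
move=> csum.
have cc : cvgn (series (fun k => c k ^+ 2)).
  by apply: nneseries_lt_pinfty_cvg => // n; exact: sqr_ge0.
pose S := limn (series (fun k => c k ^+ 2)).
pose e n := S - \sum_(k < n) c k ^+ 2.
have serE n : \sum_(k < n) c k ^+ 2 = series (fun k => c k ^+ 2) n.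
  by rewrite /series/= big_mkord.
have e0 : e n @[n --> \oo] --> 0.
  rewrite -(subrr S); apply: cvgB; first exact: cvg_cst.
  by under eq_fun do rewrite serE; exact: cc.
have leS n : \sum_(k < n) c k ^+ 2 <= S.
  rewrite serE; apply: nondecreasing_cvgn_le => //.
  by apply: nondecreasing_series => k _ _; exact: sqr_ge0.
have mps n : measurable_fun setT (psum c n \_ D).
  exact: L2_measurable (psum_L2 c n).
have [F [mF FE F0]] : exists F : T -> R, [/\ measurable_fun setT F,
    forall n, (\int[mu]_x (((psum c n \_ D) x - F x) ^+ 2)%:E <= (e n)%:E)%E &
    forall x, (forall n, (psum c n \_ D) x = 0) -> F x = 0].
  apply: L2_complete => // n m nm.
  by rewrite integral_psum_sub_sqr// lee_fin lerD2r.
have FD : F \_ D = F.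
  apply/funext => x; rewrite patchE; case: ifPn => // xD.
  by rewrite F0// => n; rewrite patchE (negbTE xD).
exists F.
- rewrite /L2/= FD; apply: sqr_integrable_Lfun2 => //.
  apply: le_lt_trans (ltry (e 0%N)); apply: le_trans (FE 0%N).
  rewrite le_eqVlt; apply/orP; left; apply/eqP; apply: eq_integral => x _.
  rewrite patchE /psum big_ord0; case: ifP; by rewrite sub0r sqrrN.
- apply: (cvgL2_sqr e0) => n; apply: le_trans (FE n).
  rewrite le_eqVlt; apply/orP; left; apply/eqP; apply: eq_integral => x _.
  congr (_ ^+ 2)%:E; rewrite -[in RHS]FD !patchE; case: ifP => // _.
  by rewrite subr0.
Qed.

(** The upper bound on rho makes L_{2,rho} a condition stronger than membership
    in L_2, so that the weighted series also controls sum_n s_n^2 lam_n, which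
    Riesz-Fischer needs to produce the sum of the path. *)
Lemma expansion_path_inP lam rho s (K : R) :
  (forall n, 0 < lam n) -> (forall n, 0 < rho n <= K) ->
  expansion_path_in mu D v lam s (weighted_L2 mu D v rho) <->
  (\sum_(0 <= n <oo) (s n ^+ 2 * lam n / rho n)%:E < +oo)%E.
Proof.
move=> lam0 rho0K; pose c n := s n * Num.sqrt (lam n).
have c_sqr n : c n ^+ 2 = s n ^+ 2 * lam n by rewrite exprMn sqr_sqrtr// ltW.
have psumE : (fun n x => \sum_(k < n) s k * (Num.sqrt (lam k) * v k x)) = psum c.
  by apply/funext => n; apply/funext => x; apply: eq_bigr => k _; rewrite mulrA.
have c_dot f : L2 mu D f -> cvgL2 mu D (psum c) f ->
    (\sum_(0 <= n <oo) (dotL2 mu D f (v n) ^+ 2 / rho n)%:E =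
     \sum_(0 <= n <oo) (s n ^+ 2 * lam n / rho n)%:E)%E.
  move=> f2 cf; apply: eq_eseriesr => n _.
  by rewrite (dotL2_cvg _ f2 cf) c_sqr.
split => [[f [f2 fsum]]|csum].
  by rewrite psumE => cf; rewrite -(c_dot f).
have rho0 n : 0 < rho n by have /andP[] := rho0K n.
have K0 : 0 <= K by have /andP[/ltW r0 rK] := rho0K 0%N; exact: le_trans rK.
have [|f f2 cf] := @riesz_fischer c.
  have t0 n : (0 <= (s n ^+ 2 * lam n / rho n)%:E)%E.
    rewrite lee_fin; apply: divr_ge0; last exact: ltW.
    by apply: mulr_ge0; [exact: sqr_ge0|exact: ltW].
  apply: (@le_lt_trans _ _ (\sum_(0 <= n <oo) K%:E * (s n ^+ 2 * lam n / rho n)%:E)%E).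
    apply: lee_nneseries => n _; first by move=> _; rewrite lee_fin sqr_ge0.
    rewrite -EFinM lee_fin c_sqr mulrCA; apply: ler_peMr.
      by rewrite mulr_ge0 ?sqr_ge0// ltW.
    by rewrite ler_pdivlMr ?mul1r//; have /andP[] := rho0K n.
  rewrite nneseriesZl; first last; first by move=> n _; exact: t0.
  by rewrite lte_mul_pinfty ?lee_fin.
by exists f; rewrite ?psumE//; split; rewrite ?(c_dot f).
Qed.

End orthonormal_expansions.

(** * Almost sure convergence and divergence of random series *)

Section weighted_borel_cantelli.
Context d (T : measurableType d) (R : realType) (P : probability T R).

Lemma ae_nneseries_lt_pinfty (f : nat -> T -> R) :
  (forall n, measurable_fun setT (f n)) -> (forall n x, 0 <= f n x) ->
  (\sum_(0 <= n <oo) \int[P]_x (f n x)%:E < +oo)%E ->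
  {ae P, forall x, (\sum_(0 <= n <oo) (f n x)%:E < +oo)%E}.
Proof.
move=> mf f0 sumf.
have mfE n : measurable_fun setT (EFin \o f n) by exact/measurable_EFinP.
have F0 x : (0 <= \sum_(0 <= n <oo) (f n x)%:E)%E.
  by apply: nneseries_ge0 => n _ _; rewrite lee_fin.
have mF : measurable_fun setT (fun x => \sum_(0 <= n <oo) (f n x)%:E)%E.
  apply: ge0_emeasurable_sum => n; last by move=> _; exact: mfE.
  by move=> x _ _; rewrite lee_fin.
have : P.-integrable setT (fun x => \sum_(0 <= n <oo) (f n x)%:E)%E.
  apply/integrableP; split => //.
  apply: le_lt_trans sumf.
  rewrite -(integral_nneseries P measurableT (f := fun k x => (f k x)%:E))//; last first.
    by move=> k x _; rewrite lee_fin.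
  apply: ge0_le_integral => //.
  - exact: measurableT_comp.
  - by move=> x _; rewrite gee0_abs.
move=> /(integrable_ae measurableT); apply: filterS => x /(_ Logic.I).
by rewrite ge0_fin_numE.
Qed.

Lemma indic_Lfun2 (A : set T) : measurable A -> (\1_A : T -> R) \in Lfun P 2%:E.
Proof.
move=> mA; apply: sqr_integrable_Lfun2; first exact: measurable_indic.
rewrite (eq_integral (fun x => (\1_A x)%:E)); last first.
  by move=> x _; rewrite indicE; case: (x \in A); rewrite ?expr1n ?expr0n.
by rewrite integral_indic// setIT (le_lt_trans (probability_le1 P mA))// ltry.
Qed.

Let Lfun21 (X : T -> R) : X \in Lfun P 2%:E -> X \in Lfun P 1.
Proof. by move=> X2; apply: Lfun_subset12 X2; exact: fin_num_measure. Qed.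

Lemma covariance_indic_indep (A B : set T) : measurable A -> measurable B ->
  P (A `&` B) = (P A * P B)%E -> covariance P \1_A (\1_B : T -> R) = 0%E.
Proof.
move=> mA mB PAB; have A2 := indic_Lfun2 mA; have B2 := indic_Lfun2 mB.
rewrite covarianceE ?Lfun2_mul_Lfun1 ?Lfun21//.
rewrite !expectation_indic// (_ : \1_A * \1_B = \1_(A `&` B)); last by rewrite indicI.
rewrite expectation_indic//; last exact: measurableI.
by rewrite PAB subee// fin_numM// fin_num_measure.
Qed.

Lemma variance_indic_le1 (A : set T) : measurable A -> ('V_P[\1_A : T -> R] <= 1)%E.
Proof.
move=> mA; rewrite varianceE ?indic_Lfun2//.
rewrite (_ : \1_A ^+ 2 = \1_A); last first.
  apply/funext => x; rewrite expr2 [LHS]/GRing.mul/= indicE.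
  by case: (x \in A); rewrite ?mulr1 ?mulr0.
rewrite expectation_indic// (le_trans _ (probability_le1 P mA))//.
by rewrite leeBlDl ?fin_numX ?fin_num_measure// leeDr// sqre_ge0.
Qed.

Variables (A : nat -> set T) (q : R) (a : nat -> R).
Hypothesis mA : forall n, measurable (A n).
Hypothesis PA : forall n, P (A n) = q%:E.
Hypothesis PAA : forall i j, i != j -> P (A i `&` A j) = (P (A i) * P (A j))%E.

Let S n x := \sum_(k < n) a k * \1_(A k) x.

Let SS n : S n.+1 = S n \+ (a n \o* \1_(A n)).
Proof. by apply/funext => x; rewrite /S big_ord_recr/= mulrC. Qed.

Let S0 : S 0 = cst 0.
Proof. by apply/funext => x; rewrite /S big_ord0. Qed.

Let aA_Lfun2 n : a n \o* \1_(A n) \in Lfun P 2%:E.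
Proof. by apply: Lfun_scale; rewrite ?ler1n// indic_Lfun2. Qed.

Let S_Lfun2 n : S n \in Lfun P 2%:E.
Proof.
have p12 : (1 <= 2%:E :> \bar R)%E by rewrite lee1n.
elim: n => [|n IH]; first by rewrite S0; exact: (Lfun_addr_closed P p12).1.
by rewrite SS; exact: (Lfun_addr_closed P p12).2.
Qed.

Let expectation_S n : ('E_P[S n] = (q * \sum_(k < n) a k)%:E)%E.
Proof.
elim: n => [|n IH]; first by rewrite S0 big_ord0 mulr0 expectation_cst.
rewrite SS expectationD ?Lfun21// IH expectationZl ?Lfun21 ?indic_Lfun2//.
by rewrite expectation_indic// PA -EFinM -EFinD big_ord_recr/= mulrDr (mulrC q (a n)).
Qed.

Let covariance_S n m : (n <= m)%N -> covariance P (S n) (a m \o* \1_(A m)) = 0%E.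
Proof.
elim: n => [|n IH] nm; first by rewrite S0 covariance_cst_l.
rewrite SS covarianceDl//.
rewrite IH ?(ltnW nm)// add0e.
have Anm : covariance P \1_(A n) (\1_(A m) : T -> R) = 0%E.
  by apply: covariance_indic_indep => //; rewrite PAA// ltn_eqF.
have A2 k := indic_Lfun2 (mA k).
rewrite (covarianceZl _ (Lfun21 (A2 n)) (Lfun21 (aA_Lfun2 m))
  (Lfun2_mul_Lfun1 (A2 n) (aA_Lfun2 m))).
rewrite (covarianceZr _ (Lfun21 (A2 n)) (Lfun21 (A2 m))
  (Lfun2_mul_Lfun1 (A2 n) (A2 m))).
by rewrite Anm !mule0.
Qed.

Let variance_S n : ('V_P[S n] <= (\sum_(k < n) a k ^+ 2)%:E)%E.
Proof.
elim: n => [|n IH]; first by rewrite S0 variance_cst big_ord0.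
rewrite SS varianceD// covariance_S// mule0 adde0 big_ord_recr/= EFinD.
apply: leeD => //; rewrite varianceZ ?indic_Lfun2//.
by rewrite -[leRHS]mule1 lee_wpmul2l ?lee_fin ?sqr_ge0// variance_indic_le1.
Qed.

(** A weighted second Borel-Cantelli lemma for pairwise independent events of
    the same probability q.  The partial sum S_n has mean q (a_0 + ... + a_(n-1)),
    which is unbounded, and variance at most C = sum a_k^2.  By Chebyshev's
    inequality, the total is at most M with probability at most C / t^2, where
    t is the excess of the mean of S_n over M. *)
Lemma ae_weighted_sum_indic_pinfty :
  0 < q -> (forall n, 0 <= a n) ->
  ~ cvgn (series a) -> cvgn (series (fun n => a n ^+ 2)) ->
  {ae P, forall x, (\sum_(0 <= n <oo) (a n * \1_(A n) x)%:E = +oo)%E}.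
Proof.
move=> q0 a0 adiv a2cvg.
have aA0 n x : 0 <= a n * \1_(A n) x by rewrite mulr_ge0.
pose F x := (\sum_(0 <= n <oo) (a n * \1_(A n) x)%:E)%E.
have mF : measurable_fun setT F.
  apply: ge0_emeasurable_sum => n; first by move=> x _ _; rewrite lee_fin.
  move=> _; apply/measurable_EFinP; apply: measurable_funM => //.
pose E (M : nat) := [set x | (F x <= M%:R%:E)%E].
have mE M : measurable (E M).
  by rewrite /E -[X in measurable X]setTI; exact: emeasurable_fun_le.
pose C := limn (series (fun n => a n ^+ 2)).
have leC n : \sum_(k < n) a k ^+ 2 <= C.
  rewrite -(big_mkord xpredT (fun k => a k ^+ 2)).
  apply: (nondecreasing_cvgn_le (u_ := series (fun k => a k ^+ 2))) => //.
  by apply: nondecreasing_series => k _ _; exact: sqr_ge0.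
have C0 : 0 <= C by have := leC 0%N; rewrite big_ord0.
have unbounded M : exists n, M < \sum_(k < n) a k.
  apply: contrapT => /forallNP aM; apply: adiv; apply: nondecreasing_is_cvgn.
    by apply: nondecreasing_series => k _ _.
  exists M => _ [n _ <-]; rewrite /series/= big_mkord leNgt.
  by apply/negP; exact: aM.
have PE0 M : P (E M) = 0%E.
  apply/eqP; rewrite eq_le measure_ge0 andbT leNgt; apply/negP => PE0.
  have PEfin : P (E M) \is a fin_num by rewrite fin_num_measure.
  pose r := fine (P (E M)).
  have r0 : 0 < r by rewrite fine_gt0// PE0/= -ge0_fin_numE.
  have PEr : P (E M) = r%:E by rewrite /r fineK.
  (* for this n the excess is t > 1 + C / r, hence r t^2 >= r t > C *)
  have [n Hn] := unbounded ((M%:R + 1 + C / r) / q).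
  pose t := q * (\sum_(k < n) a k) - M%:R.
  have Cr0 : 0 <= C / r by rewrite divr_ge0// ltW.
  have tC : 1 + C / r < t.
    by move: Hn; rewrite ltr_pdivrMr// mulrC /t; lra.
  have t0 : 0 < t by lra.
  have mS : measurable_fun setT (S n).
    by move: (S_Lfun2 n); rewrite inE => /andP[]; rewrite inE.
  pose X : {RV P >-> R} := HB.pack (S n) (isMeasurableFun.Build _ _ _ _ (S n) mS).
  have : (P (E M) <= (t ^- 2 * C)%:E)%E.
    apply: (@le_trans _ _ (P [set x | t <= `|X x - fine 'E_P[X]%E|])).
      apply: le_measure; rewrite ?inE//.
        rewrite -[X in measurable X]setTI; apply: measurable_fun_le => //.
        by apply: measurableT_comp => //; exact: measurable_funB.
      move=> x; rewrite /E/= => FM.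
      rewrite expectation_S/= distrC (le_trans _ (ler_norm _))// /t lerB//.
      rewrite -lee_fin; apply: le_trans FM.
      rewrite /S -(big_mkord xpredT (fun k => a k * \1_(A k) x)) -sumEFin.
      by apply: nneseries_lim_ge => k _ _; rewrite lee_fin.
    apply: (le_trans (chebyshev X t0)); rewrite EFinM lee_wpmul2l ?lee_fin//.
      by rewrite invr_ge0 exprn_ge0// ltW.
    by apply: (le_trans (variance_S n)); rewrite lee_fin.
  rewrite PEr lee_fin => rC.
  have : r * t ^+ 2 <= C by rewrite -ler_pdivlMr ?exprn_gt0// mulrC.
  have rt : r + C < r * t by rewrite -ltr_pdivrMl// mulrDr mulVf ?gt_eqF// mulrC.
  have : r * t <= r * t ^+ 2.
    by rewrite ler_pM2l// expr2 ler_peMl; lra.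
  by lra.
apply: (@negligibleS _ _ _ P (\bigcup_M E M)).
  move=> x /= Fx.
  have Ffin : F x \is a fin_num.
    rewrite ge0_fin_numE ?ltey; first exact/eqP.
    by apply: nneseries_ge0 => n _ _; rewrite lee_fin.
  exists (Num.truncn (fine (F x))).+1 => //=.
  by rewrite /E/= -[leLHS](fineK Ffin) lee_fin; exact/ltW/truncnS_gt.
by apply: negligible_bigcup => M; exact/(negligibleP P (mE M))/PE0.
Qed.

End weighted_borel_cantelli.

Section standardized_iid.
Context d (T : measurableType d) (R : realType) (P : probability T R).

Lemma integral_sqr_standardized (X : {RV P >-> R}) :
  'E_P[X]%E = 0%E -> 'V_P[X]%E = 1%E -> (\int[P]_x (X x ^+ 2)%:E = 1)%E.
Proof.
move=> EX0; rewrite /variance unlock EX0 unlock => <-.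
by apply: eq_integral => x _; congr EFin; rewrite /GRing.mul/= !subr0 expr2.
Qed.

(** Any threshold strictly between 0 and 1 would serve: a variable of second
    moment 1 cannot almost surely stay below it in absolute value. *)
Let far : set R := [set y | 2^-1 <= `|y|].

Let measurable_far : measurable far.
Proof.
rewrite /far -[X in measurable X]setTI; apply: measurable_fun_le => //.
Qed.

Lemma prob_far_gt0 (X : {RV P >-> R}) : (\int[P]_x (X x ^+ 2)%:E = 1)%E ->
  (0 < P (X @^-1` far))%E.
Proof.
move=> X1; rewrite lt0e measure_ge0 andbT; apply/eqP => PX0.
have mX : measurable (X @^-1` far).
  by rewrite -[X in measurable X]setTI; exact: measurable_funPT.
have : (\int[P]_x (X x ^+ 2)%:E <= \int[P]_x (4^-1)%:E)%E.
  apply: ae_ge0_le_integral => //.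
  - by move=> x _; rewrite lee_fin sqr_ge0.
  - apply/measurable_EFinP; apply: measurable_funX; exact: measurable_funPT.
  - exists (X @^-1` far); split => // x /= H; apply: contrapT => /= nfar.
    apply: H => _; rewrite lee_fin.
    move/negP: nfar; rewrite -ltNge => /ltW Xle.
    rewrite -(real_normK (num_real _)) (_ : 4^-1 = 2^-1 ^+ 2) ?lerXn2r ?nnegrE//.
    by field.
rewrite X1 integral_cst//= probability_setT mule1 lee_fin.
by lra.
Qed.

Variable s : nat -> {RV P >-> R}.
Hypothesis s_sqr : forall n, (\int[P]_x (s n x ^+ 2)%:E = 1)%E.

Lemma ae_weighted_sum_sqr_lt_pinfty (a : nat -> R) : (forall n, 0 <= a n) ->
  (\sum_(0 <= n <oo) (a n)%:E < +oo)%E ->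
  {ae P, forall x, (\sum_(0 <= n <oo) (a n * s n x ^+ 2)%:E < +oo)%E}.
Proof.
move=> a0 suma; have ms n : measurable_fun setT (fun x => s n x ^+ 2).
  by apply: measurable_funX; exact: measurable_funPT.
apply: ae_nneseries_lt_pinfty.
- by move=> n; apply: measurable_funM.
- by move=> n x; rewrite mulr_ge0// sqr_ge0.
- rewrite (eq_eseriesr (g := fun n => (a n)%:E))// => n _.
  under eq_integral do rewrite EFinM.
  rewrite ge0_integralZl ?s_sqr ?mule1//.
  + exact/measurable_EFinP.
  + by move=> x _; rewrite lee_fin sqr_ge0.
  + by rewrite lee_fin.
Qed.

Hypothesis s_indep : mutually_independent s.
Hypothesis s_ident : identically_distributed s.

(** The squares s_n^2 dominate 1/4 of the indicators of the events |s_n| >= 1/2,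
    to which ae_weighted_sum_indic_pinfty applies with harmonic weights. *)
Lemma ae_harmonic_sum_sqr_pinfty :
  {ae P, forall x, (\sum_(0 <= n <oo) (n.+1%:R^-1 * s n x ^+ 2)%:E = +oo)%E}.
Proof.
pose A n := s n @^-1` far.
have mA n : measurable (A n).
  by rewrite -[X in measurable X]setTI; exact: measurable_funPT.
have PA n : P (A n) = (fine (P (A 0%N)))%:E.
  by rewrite fineK ?fin_num_measure//; exact: (s_ident n measurable_far).
have PAA i j : i != j -> P (A i `&` A j) = (P (A i) * P (A j))%E.
  move=> ij; have := @s_indep [:: i; j] (fun=> far).
  rewrite /= inE ij/= => /(_ isT (fun=> measurable_far)).
  rewrite big_cons big_seq1 => <-; congr (P _); apply/seteqP; split => x /=.
  - by move=> [Ai Aj] k /=; rewrite !inE => /orP[]/eqP->.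
  - by move=> H; split; apply: H; rewrite /= !inE eqxx ?orbT.
have q0 : 0 < fine (P (A 0%N)).
  rewrite fine_gt0// prob_far_gt0//= (le_lt_trans (probability_le1 P (mA _)))//.
  exact: ltry.
have sq_cvg : cvgn (series (fun n => (n.+1%:R^-1 : R) ^+ 2)).
  apply: nneseries_lt_pinfty_cvg => [n|]; first exact: sqr_ge0.
  rewrite (eq_eseriesr (g := fun n => (n.+1%:R `^ (- 2))%:E)).
    by apply: nneseries_powR_lt_pinfty; rewrite ltr1n.
  by move=> n _; rewrite powRN powR_mulrn// exprVn.
have := ae_weighted_sum_indic_pinfty mA PA PAA q0
  (fun n => ltW (harmonic_gt0 n)) (@dvg_harmonic R) sq_cvg.
apply: filterS => x sumA; apply/eqP; rewrite eq_le leey/=.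
have : (4^-1%:E * \sum_(0 <= n <oo) (n.+1%:R^-1 * \1_(A n) x)%:E = +oo :> \bar R)%E.
  by rewrite sumA mulry gtr0_sg ?mul1e// invr_gt0.
move=> <-; rewrite -nneseriesZl; last 1 first.
  by move=> n _; rewrite lee_fin mulr_ge0.
apply: lee_nneseries => n _.
  by move=> _; rewrite -EFinM lee_fin !mulr_ge0.
rewrite -EFinM lee_fin mulrCA ler_wpM2l// indicE.
case: (boolP (x \in A n)); last by rewrite mulr0 sqr_ge0.
rewrite mulr1 inE /A/far/= => far_s.
rewrite -(real_normK (num_real _)) (_ : 4^-1 = 2^-1 ^+ 2) ?lerXn2r ?nnegrE//.
by field.
Qed.

End standardized_iid.

(** * Sobolev regularity of the expansion paths *)

Theorem theorem10 (R : realType) (d : nat) (Omega : set 'rV[R]_d)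
    (C : 'rV[R]_d -> 'rV[R]_d -> R) (lam : nat -> R) (v : nat -> 'rV[R]_d -> R)
    (H : set (Omega -> R)) (ip : (Omega -> R) -> (Omega -> R) -> R)
    (m : R) (rho : R -> nat -> R)
    (disp : measure_display) (Prob : measurableType disp)
    (P : probability Prob R) (s : nat -> {RV P >-> R}) :
  let mu := lebesgue_rV d in
  let COmega (x y : Omega) := C (set_val x) (set_val y) in
  let W (p : R) := weighted_L2 mu Omega v (rho p) in
  (0 < d)%N ->
  compact Omega ->
  {within Omega `*` Omega, continuous (fun z => C z.1 z.2)} ->
  symmetric_kernel COmega ->
  positive_definite_kernel COmega ->
  mercer_expansion mu Omega C lam v ->
  d%:R / 2 < m ->
  (forall p, 0 <= p -> (forall n, 0 < rho p n) /\ sobolev_decay d p (rho p)) ->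
  is_rkhs COmega H ip ->
  same_space mu H (W m) ->
  sobolev_decay d m lam ->
  mutually_independent s ->
  identically_distributed s ->
  (forall n, ('E_P[s n] = 0)%E) ->
  (forall n, ('V_P[s n] = 1)%E) ->
  {ae P, forall omega,
    (forall p, 0 <= p < m - d%:R / 2 ->
      expansion_path_in mu Omega v lam (fun n => s n omega) (W p))} /\
  {ae P, forall omega,
    ~ expansion_path_in mu Omega v lam (fun n => s n omega) (W (m - d%:R / 2))}.
Proof.
move=> mu COmega W d0 _ _ _ _ [v_basis lam0 _ _ _] dm rhoP _ _ lam_decay.
move=> s_indep s_ident sE sV.
have s_sqr n : (\int[P]_x (s n x ^+ 2)%:E = 1)%E.
  exact: integral_sqr_standardized.
have d0R : 0 < d%:R :> R by rewrite ltr0n.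
have pathP p omega : 0 <= p ->
    expansion_path_in mu Omega v lam (fun n => s n omega) (W p) <->
    (\sum_(0 <= n <oo) (s n omega ^+ 2 * lam n / rho p n)%:E < +oo)%E.
  move=> p0; have [rho0 rho_decay] := rhoP p p0.
  have [K rhoK] := sobolev_decay_le_cst d0 p0 rho0 rho_decay.
  exact: (expansion_path_inP v_basis).
have ratioP p : 0 <= p -> exists2 K, 0 < K &
    forall n, let r := n.+1%:R `^ (- (2 * (m - p) / d%:R)) in
    K^-1 * r <= lam n / rho p n <= K * r.
  by move=> p0; have [rho0 rho_decay] := rhoP p p0; exact: sobolev_decay_ratio.
split.
  pose a k (n : nat) : R := n.+1%:R `^ (- (1 + k.+1%:R^-1)).
  have : {ae P, forall omega k, (\sum_(0 <= n <oo) (a k n * s n omega ^+ 2)%:E < +oo)%E}.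
    apply: ae_foralln => k; apply: ae_weighted_sum_sqr_lt_pinfty => //.
    - by move=> n; exact: powR_ge0.
    - by apply: nneseries_powR_lt_pinfty; rewrite ltrDl.
  apply: filterS => omega sum_lt p /andP[p0 pm]; apply/pathP => //.
  have [K K0 ratioK] := ratioP p p0.
  have e0 : 0 < 2 * (m - p) / d%:R - 1.
    by rewrite subr_gt0 ltr_pdivlMr// mul1r; lra.
  (* k is such that 1 + 1/(k+1) does not exceed the exponent 2(m-p)/d *)
  pose k := Num.truncn (2 * (m - p) / d%:R - 1)^-1.
  have ke : k.+1%:R^-1 <= 2 * (m - p) / d%:R - 1.
    by rewrite invf_ple ?posrE//; exact/ltW/truncnS_gt.
  apply: (@le_lt_trans _ _ (\sum_(0 <= n <oo) K%:E * (a k n * s n omega ^+ 2)%:E)%E).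
    apply: lee_nneseries => n _.
      move=> _; rewrite lee_fin; apply: divr_ge0; last by have [/(_ n)/ltW] := rhoP p p0.
      by rewrite mulr_ge0 ?sqr_ge0// ltW.
    rewrite -EFinM lee_fin -mulrA [leRHS]mulrA [leRHS]mulrC ler_wpM2l ?sqr_ge0//.
    have /andP[_] := ratioK n => /le_trans; apply; rewrite ler_pM2l//.
    by apply: ler_powR; rewrite ?ler1n// lerN2 -lerBrDl.
  rewrite nneseriesZl; last by move=> n _; rewrite lee_fin mulr_ge0 ?sqr_ge0// powR_ge0.
  by rewrite lte_mul_pinfty ?lee_fin// ltW.
have p0 : 0 <= m - d%:R / 2 by rewrite subr_ge0 ltW.
have [K K0 ratioK] := ratioP _ p0.
have := ae_harmonic_sum_sqr_pinfty s_sqr s_indep s_ident.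
apply: filterS => omega sum_oo /(pathP _ _ p0); apply/negP; rewrite -leNgt.
have : (K^-1%:E * \sum_(0 <= n <oo) (n.+1%:R^-1 * s n omega ^+ 2)%:E = +oo :> \bar R)%E.
  by rewrite sum_oo mulry gtr0_sg ?mul1e// invr_gt0.
move=> <-; rewrite -nneseriesZl; last by move=> n _; rewrite lee_fin mulr_ge0 ?sqr_ge0.
apply: lee_nneseries => n _.
  move=> _; rewrite -EFinM lee_fin; apply: mulr_ge0; first by rewrite invr_ge0 ltW.
  by apply: mulr_ge0; [rewrite invr_ge0|exact: sqr_ge0].
rewrite -EFinM lee_fin mulrA mulrC -[leRHS]mulrA ler_wpM2l ?sqr_ge0//.
have /andP[+ _] := ratioK n; rewrite (_ : 2 * _ / _ = 1); last first.
  by field; rewrite gt_eqF.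
by rewrite powR_inv1.
Qed.
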